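(* Let $\psi:[0,\lambda_{\max})\to\mathbb{R}$, $l_0\ge 1$, $\alpha\in(0,1)$, $\eta>1$, $\overline\lambda\in(0,\lambda_{\max})$, and let $f$ be a probability density on $(0,\overline\lambda]$ that is nonincreasing and positive. For $k=0,1,2,\dots$ set $$\lambda_k=\frac{\overline\lambda}{\eta^{k+1/2}},\qquad w_k=\frac{\overline\lambda(\eta-1)f(\lambda_k\sqrt\eta)}{\eta^{k+1}}.$$ Then $$\mathrm{DM}_\alpha(v)=\sup\left\{s\in\mathbb{R}:\ \sum_{k=0}^\infty w_k\exp\{\lambda_k s-\psi(\lambda_k)v\}<\frac{l_0}{\alpha}\right\}$$ is an $l_0$-sub-$\psi$ uniform boundary with crossing probability $\alpha$.
   Context: Sub-$\psi$ condition: let $(S_t)_{t=0}^\infty$, $(V_t)_{t=0}^\infty$ be real-valued processes adapted to a filtration $(\mathcal F_t)_{t=0}^\infty$ with $S_0=V_0=0$ and $V_t\ge 0$ for all $t$. For $\psi:[0,\lambda_{\max})\to\mathbb{R}$ and $l_0\in[1,\infty)$, $(S_t)$ is $l_0$-sub-$\psi$ with variance process $(V_t)$ if for each $\lambda\in[0,\lambda_{\max})$ there is a supermartingale $(L_t(\lambda))_{t=0}^\infty$ with respect to $(\mathcal F_t)$ with $\mathbb{E}L_0(\lambda)\le l_0$ and $\exp\{\lambda S_t-\psi(\lambda)V_t\}\le L_t(\lambda)$ a.s. for all $t$. Uniform boundary: $u$ is an $l_0$-sub-$\psi$ uniform boundary with crossing probability $\alpha$ if $\mathbb{P}(\exists t\ge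 1: S_t\ge u(V_t))\le\alpha$ for every pair $(S_t,V_t)$ such that $(S_t)$ is $l_0$-sub-$\psi$ with variance process $(V_t)$. *)

(* Defs.v *)
From HB Require Import structures.
From mathcomp Require Import all_boot all_order all_algebra.
From mathcomp Require Import all_classical all_reals all_analysis.

Set Implicit Arguments.
Unset Strict Implicit.
Unset Printing Implicit Defensive.

Import Order.TTheory GRing.Theory Num.Theory.
Import numFieldNormedType.Exports.

Local Open Scope classical_set_scope.
Local Open Scope ring_scope.

Definition filtration (d : measure_display) (T : measurableType d)
    (F : nat -> set (set T)) : Prop :=
  [/\ forall t, sigma_algebra [set: T] (F t),
      forall t, F t `<=` measurable
    & forall s t, (s <= t)%N -> F s `<=` F t].

(* g_sigma_algebraType G has <<s G >> as measurable sets, i.e. G itself when G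
   is a sigma-algebra. *)
Definition measurable_wrt (d : measure_display) (T : measurableType d)
    (R : realType) (G : set (set T)) (X : T -> R) : Prop :=
  measurable_fun [set: g_sigma_algebraType G] (X : g_sigma_algebraType G -> R).

Definition adapted (d : measure_display) (T : measurableType d)
    (R : realType) (F : nat -> set (set T)) (X : nat -> T -> R) : Prop :=
  forall t, measurable_wrt (F t) (X t).

(* Y is a version of the conditional expectation E[X | G]. *)
Definition is_cond_exp (d : measure_display) (T : measurableType d)
    (R : realType) (P : probability T R) (G : set (set T))
    (X Y : T -> R) : Prop :=
  [/\ measurable_wrt G Y,
      P.-integrable [set: T] (EFin \o Y)
    & forall A : set T, G A ->
        (\int[P]_(x in A) (Y x)%:E = \int[P]_(x in A) (X x)%:E)%E].

Definition supermartingale (d : measure_display) (T : measurableType d)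
    (R : realType) (P : probability T R) (F : nat -> set (set T))
    (L : nat -> T -> R) : Prop :=
  [/\ adapted F L,
      forall t, P.-integrable [set: T] (EFin \o L t)
    & forall t, exists2 Y : T -> R,
        is_cond_exp P (F t) (L t.+1) Y
        & {ae P, forall x, Y x <= L t x}].

(* psi is only relevant on [0, lmax), where lmax may be +oo. *)
Definition sub_psi (d : measure_display) (T : measurableType d)
    (R : realType) (P : probability T R) (F : nat -> set (set T))
    (psi : R -> R) (lmax : \bar R) (l0 : R) (S V : nat -> T -> R) : Prop :=
  [/\ [/\ filtration F, adapted F S & adapted F V],
      forall x, S 0%N x = 0 /\ V 0%N x = 0,
      forall t x, 0 <= V t x
    & forall l : R, 0 <= l -> (l%:E < lmax)%E ->
        exists L : nat -> T -> R,
          [/\ supermartingale P F L,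
              ('E_P[L 0%N] <= l0%:E)%E
            & forall t, {ae P, forall x,
                expR (l * S t x - psi l * V t x) <= L t x}]].

(* The boundary is extended-real-valued, so that suprema of empty or unbounded
   sets of reals get their usual values.  The probability of the crossing set
   only makes sense when that set is an event, hence the measurability clause:
   the value of P on a non-measurable set is unspecified. *)
Definition uniform_boundary (R : realType) (psi : R -> R) (lmax : \bar R)
    (l0 alpha : R) (u : R -> \bar R) : Prop :=
  forall (d : measure_display) (T : measurableType d) (P : probability T R)
    (F : nat -> set (set T)) (S V : nat -> T -> R),
    sub_psi P F psi lmax l0 S V ->
    let crossing :=
      [set x : T | exists2 t : nat, (1 <= t)%N & (u (V t x) <= (S t x)%:E)%E] in
    measurable crossing /\ (P crossing <= alpha%:E)%E.

Definition is_density_on (R : realType) (D : set R) (f : R -> R) : Prop :=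
  [/\ measurable_fun D f,
      forall x, D x -> 0 <= f x
    & (\int[lebesgue_measure]_(x in D) (f x)%:E = 1)%E].

Definition dm_lambda (R : realType) (eta lbar : R) (k : nat) : R :=
  lbar / eta `^ (k%:R + 2^-1).

Definition dm_weight (R : realType) (eta lbar : R) (f : R -> R) (k : nat) : R :=
  lbar * (eta - 1) * f (dm_lambda eta lbar k * Num.sqrt eta) / eta ^+ k.+1.

(* The series has nonnegative terms and is summed in [0, +oo]. *)
Definition discrete_mixture_boundary (R : realType) (psi : R -> R)
    (l0 alpha eta lbar : R) (f : R -> R) (v : R) : \bar R :=
  ereal_sup [set s%:E | s in [set s : R |
    (\sum_(0 <= k <oo)
       (dm_weight eta lbar f k *
        expR (dm_lambda eta lbar k * s - psi (dm_lambda eta lbar k) * v))%:E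
     < (l0 / alpha)%:E)%E]].

(* Main.v *)
(* Since the rates dm_lambda are bounded by lbar, the series defining the boundary
   is right-continuous in s wherever it is finite; hence S_t >= DM_alpha(V_t)
   holds exactly when the mixture
     sum_k w_k exp(lambda_k S_t - psi(lambda_k) V_t)
   is at least l0 / alpha.  The weights w_k are lower Riemann terms for the
   nonincreasing density f on the intervals (lbar / eta^(k+1), lbar / eta^k], so
   they sum to at most 1.  Ville's inequality for the mixture is obtained without
   conditional expectations of infinite sums: splitting the crossing event into
   the disjoint events A_t of first crossing at time t, optional stopping gives
   sum_t E[L_t(lambda_k); A_t] <= l0 for each single k, and it remains to average
   over k and exchange the two sums. *)
Require Import Defs.
From HB Require Import structures.
From mathcomp Require Import all_boot all_order all_algebra.
From mathcomp Require Import all_classical all_reals all_analysis.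
From mathcomp Require Import measurable_realfun ring lra.

Set Implicit Arguments.
Unset Strict Implicit.
Unset Printing Implicit Defensive.

Import Order.TTheory GRing.Theory Num.Theory.
Import numFieldNormedType.Exports.

Local Open Scope classical_set_scope.
Local Open Scope ring_scope.

(** * Comparison of integrals under almost-everywhere inequalities *)

Lemma ae_le_integral_EFin d (T : measurableType d) (R : realType)
    (mu : {measure set T -> \bar R}) (D : set T) (f g : T -> R) :
  measurable D ->
  mu.-integrable D (EFin \o f) -> mu.-integrable D (EFin \o g) ->
  {ae mu, forall x, f x <= g x} ->
  (\int[mu]_(x in D) (f x)%:E <= \int[mu]_(x in D) (g x)%:E)%E.
Proof.
move=> mD intf intg [N [mN muN fgN]].
(* Removing the null set [N] from [D] changes neither integral and leaves a pointwise comparison. *)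
rewrite (negligible_integral mN mD intf muN).
rewrite (negligible_integral mN mD intg muN).
have mDN : measurable (D `\` N) by exact: measurableD.
apply: le_integral => //.
- by apply: integrableS intf => //; exact: subDsetl.
- by apply: integrableS intg => //; exact: subDsetl.
- move=> x /set_mem[_ Nx]; rewrite lee_fin; apply: contra_notT Nx => fgx.
  by apply: fgN => /=; exact/negP.
Qed.

Lemma ae_ge0_le_integral_EFin d (T : measurableType d) (R : realType)
    (mu : {measure set T -> \bar R}) (D : set T) (f g : T -> R) :
  measurable D -> measurable_fun D f -> mu.-integrable D (EFin \o g) ->
  (forall x, 0 <= f x) -> {ae mu, forall x, f x <= g x} ->
  (\int[mu]_(x in D) (f x)%:E <= \int[mu]_(x in D) (g x)%:E)%E.
Proof.
move=> mD mf intg f0 fg.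
have mg : measurable_fun D (fun x => (g x)%:E) := measurable_int mu intg.
(* f need not be integrable, so the comparison is made in the nonnegative
   integrals, with g replaced by its absolute value. *)
have -> : (\int[mu]_(x in D) (g x)%:E = \int[mu]_(x in D) `|(g x)%:E|)%E.
  apply: ae_eq_integral => //.
    exact: measurableT_comp (@abse_measurable R setT) mg.
  apply: filterS fg => x fgx _.
  by rewrite gee0_abs// lee_fin (le_trans (f0 x)).
apply: ae_ge0_le_integral => //.
- by move=> x _; rewrite lee_fin.
- exact/measurable_EFinP.
- exact: measurableT_comp (@abse_measurable R setT) mg.
- apply: filterS fg => x fgx _.
  by rewrite lee_fin (le_trans fgx)// ler_norm.
Qed.

(** * Optional stopping and the maximal inequality for mixtures *)

Section supermartingale.
Context d (T : measurableType d) (R : realType) (P : probability T R).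
Variable F : nat -> set (set T).
Hypothesis filF : filtration F.

Lemma measurable_filtration t :
  @measurable _ (g_sigma_algebraType (F t)) = F t.
Proof. by case: filF => sF _ _; exact: sigma_algebra_id. Qed.

Lemma adapted_measurable (X : nat -> T -> R) t :
  adapted F X -> measurable_fun setT (X t).
Proof.
move=> /(_ t) mX _ Y mY; have [_ + _] := filF; apply.
rewrite -measurable_filtration; exact: mX.
Qed.

(** With tau the time t at which [A t] occurs, the left side is the expectation of [L] stopped at
    min(tau, n); the last integral is over the event tau > n. Passing from n to n+1 only changes the
    integral over that event, which lies in [F n], so the supermartingale property applies there. *)
Lemma stopped_supermartingale_step (L : nat -> T -> R) (A : nat -> set T) n :
  supermartingale P F L -> (forall t, F t (A t)) -> trivIset setT A ->
  (\sum_(t < n.+1) \int[P]_(x in A t) (L t x)%:E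
     + \int[P]_(x in ~` \big[setU/set0]_(t < n.+1) A t) (L n x)%:E
    <= 'E_P[L 0%N])%E.
Proof.
move=> [adL intL superL] FA tA; pose B k := ~` \big[setU/set0]_(t < k.+1) A t.
have [sF Fm Fmono] := filF.
have mA t : measurable (A t) by exact: Fm.
have FB k : F k (B k).
  rewrite -measurable_filtration; apply: measurableC.
  apply: bigsetU_measurable => i _.
  by rewrite measurable_filtration; apply: (Fmono i); [rewrite -ltnS|].
have mB k : measurable (B k) by exact: Fm (FB k).
have intLD t D : measurable D -> P.-integrable D (EFin \o L t).
  by move=> mD; apply: integrableS (intL t).
have mL t D : measurable_fun D (fun x => (L t x)%:E).
  by apply: measurable_funTS; exact: measurable_int (intL t).
rewrite [leRHS](_ : _ = \int[P]_x (L 0%N x)%:E)%E; last by rewrite unlock.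
elim: n => [|n ih].
  rewrite big_ord1 -/(B 0%N) -integral_setU//; last first.
    by rewrite /B big_ord1; exact/disj_setPCl.
  by rewrite /B big_ord1 setUCr.
(* Either stopping occurs at time n+1 or it has not occurred by then; disjointness of the [A t] puts
   [A n.+1] inside [B n]. *)
have BS : B n = A n.+1 `|` B n.+1.
  rewrite /B [in RHS]big_ord_recr/= setCU setUIr setUCr setIT.
  rewrite setUC; apply/esym/setUidPl => x Ax.
  rewrite -bigcup_mkord => -[i/= ilt Aix].
  have ieq : i = n.+1 by apply: (tA i n.+1) => //; exists x.
  by rewrite ieq ltnn in ilt.
rewrite big_ord_recr/= -/(B n.+1) -addeA -integral_setU//; last first.
  apply/disj_setPCl.
  by rewrite big_ord_recr/=; exact: subsetUr.
rewrite -BS; apply: le_trans ih; apply: leeD2l.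
have [Y [_ intY condY] YL] := superL n.
(* Since [B n] belongs to [F n], [L n.+1] may be replaced by its conditional expectation [Y], which
   is almost everywhere at most [L n]. *)
rewrite -condY//.
apply: ae_le_integral_EFin => //; first exact: integrableS intY.
exact: intLD.
Qed.

Lemma stopped_supermartingale (L : nat -> T -> R) (A : nat -> set T) :
  supermartingale P F L -> (forall t, F t (A t)) -> trivIset setT A ->
  (forall t, {ae P, forall x, 0 <= L t x}) ->
  (\sum_(0 <= t <oo) \int[P]_(x in A t) (L t x)%:E <= 'E_P[L 0%N])%E.
Proof.
move=> supL FA tA L0.
have [sF Fm Fmono] := filF.
have intL0 t D : measurable D -> (0 <= \int[P]_(x in D) (L t x)%:E)%E.
  move=> mD; rewrite -(integral0 P D).
  (* [L t] is nonnegative only almost everywhere, hence the comparison with the zero function. *)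
  apply: (@ae_ge0_le_integral_EFin _ _ _ P D (cst 0)) => //.
  by case: supL => _ + _ => /(_ t); exact: integrableS.
have intA0 t : (0 <= \int[P]_(x in A t) (L t x)%:E)%E by exact/intL0/Fm/FA.
apply: lime_le; first exact: is_cvg_nneseries.
apply: nearW => n; rewrite big_mkord.
apply: le_trans (stopped_supermartingale_step n supL FA tA).
(* The partial sum stops before n, so both the term at time n and the integral over the unstopped
   event are dropped as nonnegative. *)
rewrite big_ord_recr/= -addeA leeDl// adde_ge0// intL0//.
apply: measurableC; apply: bigsetU_measurable => i _; exact: Fm (FA i).
Qed.

Lemma mixture_maximal_inequality (psi : R -> R) (lmax : \bar R) (l0 c : R)
    (S V : nat -> T -> R) (lam w : nat -> R) (E : nat -> set T) :
  sub_psi P F psi lmax l0 S V ->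
  (forall k, 0 <= lam k /\ ((lam k)%:E < lmax)%E) -> (forall k, 0 <= w k) ->
  (\sum_(0 <= k <oo) (w k)%:E <= 1)%E -> 0 <= l0 -> 0 <= c ->
  (forall t, F t (E t)) ->
  (forall t x, E t x -> (c%:E <= \sum_(0 <= k <oo)
      (w k * expR (lam k * S t x - psi (lam k) * V t x))%:E)%E) ->
  (c%:E * P (\bigcup_t E t) <= l0%:E)%E.
Proof.
move=> [[_ adS adV] _ _ subpsi] lamP w0 w1 l00 c0 FE cE.
have [sF Fm Fmono] := filF.
(* [A t] is the event that [E] occurs for the first time at t. *)
pose A := seqDU E.
have tA : trivIset setT A := trivIset_seqDU E.
have FA t : F t (A t).
  rewrite -measurable_filtration; apply: measurableD.
    by rewrite measurable_filtration.
  apply: bigsetU_measurable => i _.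
  by rewrite measurable_filtration; apply: (Fmono i); [exact: ltnW|].
have mA t : measurable (A t) by exact: Fm.
pose Z k t x := expR (lam k * S t x - psi (lam k) * V t x).
have mZ k t D : measurable_fun D (Z k t).
  apply: measurable_funTS; apply: measurableT_comp => //.
  by apply: measurable_funB; apply: measurable_funM => //;
    exact: adapted_measurable.
have Zl0 k : (\sum_(0 <= t <oo) \int[P]_(x in A t) (Z k t x)%:E <= l0%:E)%E.
  have [lamk0 lamkmax] := lamP k.
  have [L [supL EL0 ZL]] := subpsi _ lamk0 lamkmax.
  apply: le_trans EL0.
  have L0 t : {ae P, forall x, 0 <= L t x}.
    by apply: filterS (ZL t) => x; apply: le_trans; exact: expR_ge0.
  apply: le_trans (stopped_supermartingale supL FA tA L0).
  apply: lee_nneseries => t _.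
    by move=> _; apply: integral_ge0 => x _; rewrite lee_fin expR_ge0.
  apply: ae_ge0_le_integral_EFin => //.
  - by case: supL => _ + _ => /(_ t); exact: integrableS.
  - by move=> x; exact: expR_ge0.
  - exact: ZL.
have wZ0 k t x : (0 <= (w k * Z k t x)%:E)%E.
  by rewrite lee_fin mulr_ge0// expR_ge0.
rewrite seqDU_bigcup_eq measure_semi_bigcup//; last exact: bigcupT_measurable.
rewrite -nneseriesZl//.
apply: (@le_trans _ _ (\sum_(0 <= t <oo) \sum_(0 <= k <oo)
    (w k)%:E * \int[P]_(x in A t) (Z k t x)%:E))%E.
  apply: lee_nneseries => t _; first by rewrite mule_ge0.
  (* Markov's inequality on [A t]: the constant c is integrated over a set where the mixture is at
     least c, and monotone convergence integrates the mixture termwise. *)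
  rewrite -[leLHS]integral_cst//.
  rewrite (_ : (\sum_(0 <= k <oo) _)%E =
      (\int[P]_(x in A t) \sum_(0 <= k <oo) (w k * Z k t x)%:E)%E); last first.
    rewrite integral_nneseries//; last first.
      by move=> k; apply/measurable_EFinP; apply: measurable_funM.
    apply: eq_eseriesr => k _; rewrite -ge0_integralZl_EFin//.
    - by move=> x _; rewrite lee_fin expR_ge0.
    - exact/measurable_EFinP.
  apply: ge0_le_integral => //.
  - apply: ge0_emeasurable_sum => [k x _ _|k _]; first exact: wZ0.
    by apply/measurable_EFinP; apply: measurable_funM.
  - by move=> x [+ _]; exact: cE.
rewrite nneseries_interchange; last first.
  move=> t k; rewrite mule_ge0//; first by rewrite lee_fin.
  by apply: integral_ge0 => x _; rewrite lee_fin expR_ge0.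
(* After the interchange, the inner sum over t is at most l0 for each k by [Zl0], and the weights
   sum to at most 1. *)
apply: (@le_trans _ _ (\sum_(0 <= k <oo) l0%:E * (w k)%:E)%E); last first.
  rewrite nneseriesZl; last by move=> k _; rewrite lee_fin.
  by rewrite -[leRHS]mule1 lee_wpmul2l// lee_fin.
apply: lee_nneseries => k _.
  move=> _; apply: nneseries_ge0 => t _ _.
  rewrite mule_ge0//; first by rewrite lee_fin.
  by apply: integral_ge0 => x _; rewrite lee_fin expR_ge0.
rewrite nneseriesZl; last first.
  by move=> t _; apply: integral_ge0 => x _; rewrite lee_fin expR_ge0.
by rewrite muleC lee_wpmul2r// lee_fin.
Qed.

End supermartingale.

(** * Total mass of the weights *)

Lemma density_geometric_sum (R : realType) (eta lbar : R) (f : R -> R) :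
  1 < eta -> 0 < lbar -> is_density_on `]0, lbar] f ->
  {in `]0, lbar] &, {homo f : x y / x <= y >-> y <= x}} ->
  (\sum_(0 <= k <oo)
    (lbar * (eta - 1) * f (lbar / eta ^+ k) / eta ^+ k.+1)%:E <= 1)%E.
Proof.
(* The bound 1 is replaced by the integral of the density. *)
move=> eta1 lbar0 [mf f0 <-] fdec.
have eta0 : 0 < eta by exact: lt_trans eta1.
pose I k := `]lbar / eta ^+ k.+1, lbar / eta ^+ k]%classic : set R.
have e0 k : 0 < lbar / eta ^+ k by rewrite divr_gt0// exprn_gt0.
have ele i j : (i <= j)%N -> lbar / eta ^+ j <= lbar / eta ^+ i.
  move=> ij; rewrite ler_pM2l// lef_pV2 ?posrE ?exprn_gt0//.
  by rewrite ler_eXn2l.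
have elbar k : lbar / eta ^+ k <= lbar.
  by have := ele 0%N k isT; rewrite expr0 divr1.
have Isub k : I k `<=` `]0, lbar]%classic.
  move=> x; rewrite /I /= !in_itv/= => /andP[lx xu].
  by rewrite (lt_trans (e0 k.+1) lx) (le_trans xu).
have mI k : measurable (I k) by exact: measurable_itv.
have tI : trivIset setT I.
  apply: ltn_trivIset => m n mn; rewrite -subset0 => x [].
  rewrite /I /= !in_itv/= => /andP[nx _] /andP[_ xm].
  by have := lt_le_trans (le_lt_trans (ele _ _ mn) nx) xm; rewrite ltxx.
apply: (@le_trans _ _ (\sum_(0 <= k <oo)
    \int[lebesgue_measure]_(x in I k) (f x)%:E)%E).
  apply: lee_nneseries => k _.
    move=> _; rewrite lee_fin divr_ge0 ?exprn_ge0 ?(ltW eta0)//.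
    rewrite !mulr_ge0 ?subr_ge0 ?(ltW lbar0) ?(ltW eta1)//.
    by apply: f0; rewrite /= in_itv/= e0/=.
  have lk := e0 k.
  (* The k-th term is the length lbar (eta - 1) / eta^(k+1) of [I k] times the value of f at its
     right endpoint, where f is smallest on [I k]. *)
  apply: (@le_trans _ _ (\int[lebesgue_measure]_(x in I k)
      (f (lbar / eta ^+ k))%:E)%E).
    have muI : lebesgue_measure (I k) =
        (lbar / eta ^+ k - lbar / eta ^+ k.+1)%:E :> \bar R.
      rewrite /I lebesgue_measure_itv/= lte_fin ifT ?EFinB//.
      by rewrite ltr_pM2l// ltf_pV2 ?posrE ?exprn_gt0// ltr_eXn2l.
    have -> : (\int[lebesgue_measure]_(x in I k) (f (lbar / eta ^+ k))%:E =
        (f (lbar / eta ^+ k))%:E * lebesgue_measure (I k))%E.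
      by rewrite integral_cst//; exact: mI.
    rewrite muI -EFinM lee_fin exprS le_eqVlt; apply/orP; left.
    by apply/eqP; field; rewrite !gt_eqF ?exprn_gt0.
  apply: ge0_le_integral => //; first exact: mI.
  - by move=> x _; rewrite lee_fin f0//= in_itv/= lk elbar.
  - apply/measurable_EFinP; apply: measurable_funS (@Isub k) mf.
    exact: measurable_itv.
  - move=> x Ix; rewrite lee_fin; apply: fdec.
    + exact: (Isub k).
    + by rewrite in_itv/= lk elbar.
    + by move: Ix; rewrite /I /= in_itv/= => /andP[].
have mUI : measurable (\bigcup_k I k) by exact: bigcupT_measurable.
have IU : \bigcup_k I k `<=` `]0, lbar]%classic by move=> x [k _]; exact: Isub.
have mfE : measurable_fun `]0, lbar] (fun x => (f x)%:E).
  exact/measurable_EFinP.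
rewrite -ge0_integral_bigcup//; last 2 first.
- exact: measurable_funS mfE.
- by move=> x /IU xI; rewrite lee_fin f0.
exact: ge0_subset_integral.
Qed.

(** * The rates, and the boundary as a threshold for the mixture *)

Lemma dm_lambda_gt0 (R : realType) (eta lbar : R) k :
  1 < eta -> 0 < lbar -> 0 < dm_lambda eta lbar k.
Proof.
by move=> eta1 lbar0; rewrite divr_gt0// powR_gt0// (lt_trans _ eta1).
Qed.

Lemma dm_lambda_le (R : realType) (eta lbar : R) k :
  1 < eta -> 0 < lbar -> dm_lambda eta lbar k <= lbar.
Proof.
move=> eta1 lbar0; have eta0 : 0 < eta by exact: lt_trans eta1.
rewrite ler_pdivrMr ?powR_gt0// ler_peMr ?(ltW lbar0)//.
by rewrite -[leLHS](powRr0 eta) ler_powR ?(ltW eta1)// addr_ge0// invr_ge0.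
Qed.

(** The rate is the geometric mean of the endpoints of the k-th interval, so the factor sqrt(eta)
    moves it to the right endpoint. *)
Lemma dm_lambda_sqrt (R : realType) (eta lbar : R) k :
  1 < eta -> dm_lambda eta lbar k * Num.sqrt eta = lbar / eta ^+ k.
Proof.
move=> eta1; have eta0 : 0 < eta by exact: lt_trans eta1.
rewrite /dm_lambda powRD; last by rewrite gt_eqF ?implybT.
rewrite powR_mulrn ?(ltW eta0)// powR12_sqrt ?(ltW eta0)//.
have s0 : Num.sqrt eta != 0 by rewrite gt_eqF ?sqrtr_gt0.
by field; rewrite s0 gt_eqF ?exprn_gt0.
Qed.



Lemma discrete_mixture_boundary_le (R : realType) (psi : R -> R)
    (l0 alpha eta lbar : R) (f : R -> R) (v s : R) :
  1 < eta -> 0 < lbar -> (forall k, 0 <= dm_weight eta lbar f k) ->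
  ((discrete_mixture_boundary psi l0 alpha eta lbar f v <= s%:E) =
   ((l0 / alpha)%:E <= \sum_(0 <= k <oo)
      (dm_weight eta lbar f k *
       expR (dm_lambda eta lbar k * s - psi (dm_lambda eta lbar k) * v))%:E))%E.
Proof.
move=> eta1 lbar0 w0.
rewrite /discrete_mixture_boundary; move: (l0 / alpha) => c.
pose lam := dm_lambda eta lbar; pose w := dm_weight eta lbar f.
pose h s k := w k * expR (lam k * s - psi (lam k) * v).
have h0 s' k : (0 <= (h s' k)%:E)%E by rewrite lee_fin mulr_ge0// expR_ge0.
pose G s : \bar R := (\sum_(0 <= k <oo) (h s k)%:E)%E.
rewrite -/(G s); apply/idP/idP => [DMs|cG].
  rewrite leNgt; apply/negP => Gc.
  have G0 : (0 <= G s)%E by exact: nneseries_ge0.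
  have Gfin : G s \is a fin_num.
    by rewrite ge0_fin_numE// (lt_trans Gc) ?ltry.
  set g := fine (G s); have gE : G s = g%:E by rewrite fineK.
  have g0 : 0 <= g by rewrite -lee_fin -gE.
  have gc : g < c by rewrite -lte_fin -gE.
  (* expR y * g is the harmonic mean of g and c. *)
  pose y := ln (2 * c / (g + c)).
  have c0 : 0 < c by exact: le_lt_trans gc.
  have gc0 : 0 < g + c by exact: ltr_wpDl.
  have y0 : 0 < y by rewrite ln_gt0// ltr_pdivlMr// mul1r; lra.
  have yg : expR y * g < c.
    rewrite lnK ?posrE ?divr_gt0 ?mulr_gt0//.
    by rewrite mulrAC ltr_pdivrMr//; nra.
  (* As every rate is at most lbar, a shift of s by y / lbar raises each exponent by at most y and
     multiplies the series by at most [expR y]. The shifted point thus stays in the defining set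
     although it exceeds s. *)
  have : (G (s + y / lbar)%R < c%:E)%E.
    apply: (@le_lt_trans _ _ (\sum_(0 <= k <oo) (expR y)%:E * (h s k)%:E)%E).
      apply: lee_nneseries => // k _; rewrite -EFinM lee_fin mulrCA.
      rewrite ler_wpM2l// -expRD ler_expR mulrDr.
      have : lam k * (y / lbar) <= y.
        by rewrite mulrCA ler_piMr ?(ltW y0)// ler_pdivrMr// mul1r dm_lambda_le.
      lra.
    by rewrite nneseriesZl// -/(G s) gE -EFinM lte_fin.
  move=> Gsy; move: DMs => /ereal_supP /(_ (s + y / lbar)%:E).
  rewrite lee_fin gerDl leNgt divr_gt0// => absurd.
  by suff : false by []; apply: absurd; exists (s + y / lbar).
(* Conversely, positive rates make [G] nondecreasing, so a point s' > s of the defining set would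
   give G s <= G s' < c <= G s. *)
apply/ereal_supP => _ [s' /= Gs' <-]; rewrite lee_fin leNgt; apply/negP => ss'.
have : (G s < G s)%E; last by rewrite ltxx.
apply: le_lt_trans (lt_le_trans Gs' cG).
apply: lee_nneseries => // k _; rewrite lee_fin ler_wpM2l// ler_expR.
by rewrite lerB// ler_pM2l ?dm_lambda_gt0// ltW.
Qed.

(** * Measurability of the crossing event and the probability bound *)

Theorem theorem2 (R : realType) (lmax : \bar R) (psi : R -> R)
    (l0 alpha eta lbar : R) (f : R -> R)
    (hl0 : 1 <= l0)
    (halpha0 : 0 < alpha) (halpha1 : alpha < 1)
    (heta : 1 < eta)
    (hlbar0 : 0 < lbar) (hlbar1 : (lbar%:E < lmax)%E)
    (hf_density : is_density_on `]0, lbar] f)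
    (hf_noninc : {in `]0, lbar] &, {homo f : x y / x <= y >-> y <= x}})
    (hf_pos : {in `]0, lbar], forall x, 0 < f x}) :
  uniform_boundary psi lmax l0 alpha
    (discrete_mixture_boundary psi l0 alpha eta lbar f).
Proof.
move=> d T P F S V subpsi crossing.
have eta0 : 0 < eta by exact: lt_trans heta.
have w1 := density_geometric_sum heta hlbar0 hf_density hf_noninc.
pose lam := dm_lambda eta lbar; pose w := dm_weight eta lbar f.
have wE k : w k = lbar * (eta - 1) * f (lbar / eta ^+ k) / eta ^+ k.+1.
  by rewrite /w /dm_weight dm_lambda_sqrt.
have w0 k : 0 <= w k.
  rewrite wE divr_ge0 ?exprn_ge0 ?(ltW eta0)//.
  rewrite !mulr_ge0 ?subr_ge0 ?(ltW hlbar0) ?(ltW heta)// ltW// hf_pos//.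
  rewrite in_itv/= divr_gt0 ?exprn_gt0//= ler_pdivrMr ?exprn_gt0//.
  by rewrite ler_peMr ?(ltW hlbar0)// exprn_ege1// ltW.
have l00 : 0 < l0 by exact: lt_le_trans hl0.
have [[filF adS adV] _ _ _] := subpsi.
have [sF Fm Fmono] := filF.
(* The clause 1 <= t makes [E 0] empty, so the union can run over all t. *)
pose E t := [set x | (1 <= t)%N /\ ((l0 / alpha)%:E <=
  \sum_(0 <= k <oo) (w k * expR (lam k * S t x - psi (lam k) * V t x))%:E)%E].
have crossingE : crossing = \bigcup_t E t.
  apply/seteqP; split => x.
    move=> [t t1]; rewrite discrete_mixture_boundary_le// => ?.
    by exists t.
  move=> [t _ [t1 ?]]; exists t => //.
  by rewrite discrete_mixture_boundary_le.
have FE t : F t (E t).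
  have [t0|t1] := ltnP t 1.
    have -> : E t = set0.
      by rewrite -subset0 => x [t1 _]; rewrite leqNgt t0 in t1.
    by case: (sF t).
  (* The superlevel set is taken in the type carrying [F t], so that measurability is proved
     relative to [F t] and not to the ambient sigma-algebra. *)
  have -> : E t = setT `&` [set x : g_sigma_algebraType (F t) |
      ((l0 / alpha)%:E <= \sum_(0 <= k <oo)
        (w k * expR (lam k * S t x - psi (lam k) * V t x))%:E)%E].
    by apply/seteqP; split => x [].
  rewrite -(measurable_filtration filF).
  apply: emeasurable_fun_c_infty => //.
  apply: ge0_emeasurable_sum => [k x _ _|k _].
    by rewrite lee_fin mulr_ge0// expR_ge0.
  apply/measurable_EFinP; apply: measurable_funM => //.
  apply: measurableT_comp => //.
  by apply: measurable_funB; apply: measurable_funM => //;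
    [exact: adS|exact: adV].
have mUE : measurable (\bigcup_t E t).
  by apply: bigcupT_measurable => t; exact: Fm (FE t).
rewrite crossingE; split => //.
have : ((l0 / alpha)%:E * P (\bigcup_t E t) <= l0%:E)%E.
  apply: (mixture_maximal_inequality filF (lam := lam) subpsi _ w0) => //.
  - move=> k; split; first by rewrite ltW// dm_lambda_gt0.
    by apply: le_lt_trans hlbar1; rewrite lee_fin; exact: dm_lambda_le.
  - by under eq_eseriesr do rewrite wE.
  - exact: ltW.
  - by rewrite divr_ge0 ?ltW.
  - by move=> t x [].
(* The probability is finite, so the factor l0 > 0 can be cancelled in the reals. *)
have /fineK <- : P (\bigcup_t E t) \is a fin_num by exact: fin_num_measure.
rewrite -EFinM !lee_fin mulrAC ler_pdivrMr//.
by rewrite ler_pM2l.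
Qed.
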